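(* Let $n\in\mathbb{Z}^+$ and let $S\subseteq 2\mathbb{Z}^+$ be a set of positive even integers. Then $$|\mathrm{UPF}^{\mathrm{T1}}_{n,S}|=\sum_{m\in S}\sum_{j=1}^{m}(-1)^{m-j}\binom{m}{j}j^n.$$
   Context: A parking preference $(a_1,\dots,a_n)\in[n]^n$ describes $n$ cars entering a one-way street with spots $1,\dots,n$ in the order $1,2,\dots,n$; car $i$ parks in the first unoccupied spot numbered $\ge a_i$. It is a parking function if all cars park. It is a unit interval parking function if it is a parking function and every car $i$ parks in spot $a_i$ or spot $a_i+1$. Car $i$ is lucky if it parks in spot $a_i$. $\mathrm{UPF}^{\mathrm{T1}}_{n,S}$ is the set of unit interval parking functions of length $n$ whose number of lucky cars belongs to $S$. *)

(* Defs.v *)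
From mathcomp Require Export all_boot all_order all_algebra.
From mathcomp Require Export boolp classical_sets cardinality fsbigop.

Set Implicit Arguments.
Unset Strict Implicit.
Unset Printing Implicit Defensive.


(* Spots and preferences [n] = {1, .., n} are encoded as 'I_n: the ordinal k
   stands for spot k + 1. *)

(* [enum 'I_n] lists the spots in increasing order, so this is the first
   unoccupied spot at or after [p]; [None] means that the car leaves the street
   without parking. *)
Definition first_free (n : nat) (occ : {set 'I_n}) (p : 'I_n) : option 'I_n :=
  ohead [seq s : 'I_n <- enum 'I_n | (p <= s) && (s \notin occ)].

Fixpoint park (n : nat) (occ : {set 'I_n}) (prefs : seq 'I_n) : seq (option 'I_n) :=
  if prefs is p :: prefs' then
    let o := first_free occ p in
    o :: park (if o is Some s then s |: occ else occ) prefs'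
  else [::].

Definition spot (n : nat) (a : n.-tuple 'I_n) (i : 'I_n) : option 'I_n :=
  nth None (park finset.set0 a) i.

Definition parking_function (n : nat) (a : n.-tuple 'I_n) : bool :=
  [forall i, spot a i != None].

Definition unit_interval_pf (n : nat) (a : n.-tuple 'I_n) : bool :=
  parking_function a &&
  [forall i, if spot a i is Some s
             then (s == tnth a i) || (s == (tnth a i).+1 :> nat)
             else false].

Definition lucky (n : nat) (a : n.-tuple 'I_n) (i : 'I_n) : bool :=
  spot a i == Some (tnth a i).

Definition num_lucky (n : nat) (a : n.-tuple 'I_n) : nat := #|[set i | lucky a i]%SET|.

Definition UPF_T1 (n : nat) (S : set nat) : {set n.-tuple 'I_n} :=
  [set a : n.-tuple 'I_n | unit_interval_pf a && (num_lucky a \in S)]%SET.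

(* Main.v *)
Require Import Defs.
Import GRing.Theory Num.Theory.

(** A unit interval parking function with [m] lucky cars is the same thing as a
    surjection from the cars onto [m] blocks. The lucky spots cut the street
    into [m] intervals, and an unlucky car parks right after a car that arrived
    earlier, so the cars of each interval appear in their order of arrival. The
    outcome is therefore recovered from the map sending a car to its interval:
    car [i] parks at the rank of [(f i, i)] in the lexicographic order, and it
    is lucky iff it is the first car of its block. Surjections are then counted
    by inclusion-exclusion, whose term [j = 0] vanishes because [0 < n]. *)

Set Implicit Arguments.
Unset Strict Implicit.
Unset Printing Implicit Defensive.

(** * The parking process, car by car *)

(** [enum 'I_n] is strictly increasing and filtering preserves this, so the head of the filtered
    list is the least admissible spot. *)
Lemma first_freeP (n : nat) (occ : {set 'I_n}) (p s : 'I_n) :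
  reflect [/\ p <= s, s \notin occ & forall t : 'I_n, p <= t -> t < s -> t \in occ]
    (first_free occ p == Some s).
Proof.
rewrite /first_free; set P := (fun t : 'I_n => _).
have memP t : (t \in [seq t <- enum 'I_n | P t]) = P t.
  by rewrite mem_filter mem_enum andbT.
have srt : sorted (fun x y : 'I_n => x < y) [seq t <- enum 'I_n | P t].
  apply: sorted_filter => [y x z|]; first exact: ltn_trans.
  have := iota_ltn_sorted 0 n; rewrite -val_enum_ord sorted_map.
  exact: sub_sorted.
case: [seq t <- enum 'I_n | P t] memP srt => [|u l] /= memP srt.
  constructor=> -[ps sN _]; have := memP s.
  by rewrite in_nil /P ps sN.
have u_min t : P t -> u <= t.
  rewrite -memP inE => /predU1P[-> //|tl].
  move: srt; rewrite path_sortedE => [/andP[/allP/(_ t tl)/ltnW]//|].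
  by move=> y x z; exact: ltn_trans.
have /andP[pu uN] : P u by rewrite -memP mem_head.
apply: (iffP eqP) => [[<-]|[ps sN smin]].
  split=> // t pt tu; apply/negPn/negP => tN.
  by have := u_min t; rewrite /P pt tN leqNgt tu => /(_ isT).
congr Some; apply/val_inj/eqP; rewrite eqn_leq u_min /P ?ps ?sN //=.
by rewrite leqNgt; apply: contra uN => us; exact: smin.
Qed.

Lemma size_park (n : nat) (occ : {set 'I_n}) (p : seq 'I_n) :
  size (park occ p) = size p.
Proof. by elim: p occ => //= x p IHp occ; rewrite IHp. Qed.

Lemma nth_park (n : nat) (occ : {set 'I_n}) (p : seq 'I_n) (x0 : 'I_n) (k : nat) :
  k < size p ->
  nth None (park occ p) k =
  first_free (occ :|: [set s | Some s \in take k (park occ p)]) (nth x0 p k).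
Proof.
elim: p occ k => //= x p IHp occ [|k] /= k_lt.
  by congr first_free; apply/setP => s; rewrite !inE orbF.
rewrite IHp //; congr first_free; apply/setP => s; rewrite !inE.
case: (first_free occ x) => [t|] /=; last by [].
by rewrite !inE (inj_eq (@Some_inj _)) orbCA orbA.
Qed.

(** Replaces the recursion on the list of cars by a course-of-values recursion on the arrival index,
    the form used in every later argument about parking. *)
Lemma spotE (n : nat) (a : n.-tuple 'I_n) (i : 'I_n) :
  spot a i =
  first_free [set s | [exists j : 'I_n, (j < i) && (spot a j == Some s)]] (tnth a i).
Proof.
rewrite /spot (@nth_park _ _ _ (tnth a i)) ?size_tuple // -tnth_nth.
congr first_free; apply/setP => s; rewrite !inE /=.
apply/idP/existsP => [/(nthP None)[k]|[j /andP[ji /eqP js]]].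
  rewrite size_take size_park size_tuple ltn_ord => ki.
  rewrite nth_take // => ks; exists (Ordinal (ltn_trans ki (ltn_ord i))).
  by rewrite ki /= ks.
rewrite -js -(nth_take _ ji) mem_nth // size_take size_park size_tuple.
by rewrite ltn_ord.
Qed.

(* A car that does not park gets its preferred spot as a junk value. *)
Definition outcome (n : nat) (a : n.-tuple 'I_n) (i : 'I_n) : 'I_n :=
  odflt (tnth a i) (spot a i).

(** * Structure of unit interval parking functions *)

Section UnitInterval.
Variables (n : nat) (a : n.-tuple 'I_n).

Lemma spot_outcome : unit_interval_pf a -> forall i, spot a i = Some (outcome a i).
Proof.
by move=> /andP[/forallP pf _] i; have := pf i; rewrite /outcome; case: (spot a i).
Qed.

Lemma luckyE : unit_interval_pf a ->
  forall i, lucky a i = (outcome a i == tnth a i).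
Proof. by move=> ua i; rewrite /lucky spot_outcome // (inj_eq (@Some_inj _)). Qed.

Lemma outcome_inj : unit_interval_pf a -> injective (outcome a).
Proof.
move=> ua.
have neq (i j : 'I_n) : i < j -> outcome a i != outcome a j.
  move=> ij; have /eqP := spot_outcome ua j; rewrite spotE => /first_freeP[_ jN _].
  apply: contra jN => /eqP eij; rewrite inE; apply/existsP; exists i.
  by rewrite ij spot_outcome // eij eqxx.
move=> i j eij; apply/val_inj; case: (ltngtP i j) => // /neq; rewrite eij eqxx //.
Qed.

(** An unlucky car has skipped its preferred spot, which must therefore hold an earlier car; the
    unit interval condition puts the unlucky car right behind it. *)
Lemma unluckyP : unit_interval_pf a -> forall i, ~~ lucky a i ->
  exists2 j : 'I_n, j < i &
    outcome a j = tnth a i /\ outcome a i = (tnth a i).+1 :> nat.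
Proof.
move=> ua i; rewrite luckyE // => iN.
have /andP[_ /forallP/(_ i)] := ua.
rewrite spot_outcome // (negPf iN) /= => /eqP eqS.
have /eqP := spot_outcome ua i; rewrite spotE => /first_freeP[_ _].
move=> /(_ (tnth a i) (leqnn _)); rewrite eqS ltnSn => /(_ isT).
rewrite inE => /existsP[j /andP[ji]]; rewrite spot_outcome // => /eqP[ej].
by exists j.
Qed.

(** Walk left from the spot of [j] to that of [i]: each car met before [i] is unlucky, so its left
    neighbour arrived before it. Arrival indices thus decrease all the way down to [i]. *)
Lemma lt_of_no_lucky : unit_interval_pf a -> forall i j : 'I_n,
  outcome a i < outcome a j ->
  (forall k, lucky a k -> outcome a i < outcome a k <= outcome a j -> False) ->
  i < j.
Proof.
move=> ua i j; have [d] := ubnP (outcome a j); elim: d j => // d IHd j jd ij noL.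
have [jl|jN] := boolP (lucky a j); first by case: (noL j jl); rewrite ij leqnn.
have [k kj [ek ej]] := unluckyP ua jN.
apply: (leq_ltn_trans _ kj).
case: (ltngtP (outcome a i) (outcome a k)) => [ik|ki|/val_inj/(outcome_inj ua)->//].
  apply/ltnW/IHd => // [|l ll /andP[il lk]].
    by move: jd; rewrite ej ek.
  by apply: (noL l ll); rewrite il ej -ek (leq_trans lk).
by move: ij; rewrite ej ltnS -ek leqNgt ki.
Qed.

End UnitInterval.

(** Strong induction on arrival: if the earlier cars follow [s], then [s i] is free by injectivity,
    and the only spot that car [i] may have to skip is its preference, taken by [j]. This certifies
    an outcome without running the process. *)
Lemma outcome_unique (n : nat) (a : n.-tuple 'I_n) (s : 'I_n -> 'I_n) :
  injective s ->
  (forall i, s i = tnth a i \/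
     s i = (tnth a i).+1 :> nat /\ exists2 j : 'I_n, j < i & s j = tnth a i) ->
  unit_interval_pf a /\ outcome a =1 s.
Proof.
move=> s_inj hs.
have sp i : spot a i = Some (s i).
  have [d] := ubnP (val i); elim: d i => // d IHd i id.
  rewrite spotE; apply/eqP/first_freeP.
  have mem_occ t : (t \in [set s | [exists j : 'I_n, (j < i) && (spot a j == Some s)]])
      = [exists j : 'I_n, (j < i) && (s j == t)].
    rewrite inE; apply: eq_existsb => j; case: (ltnP j i) => //= ji.
    by rewrite IHd ?(inj_eq (@Some_inj _)) // (leq_trans ji).
  split.
  - by case: (hs i) => [->|[-> _]].
  - rewrite mem_occ; apply/existsP => -[j /andP[ji /eqP/s_inj ej]].
    by rewrite ej ltnn in ji.
  - move=> t; rewrite mem_occ; case: (hs i) => [->|[-> [j ji ej]]] at_ ta.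
      by rewrite ltnNge at_ in ta.
    apply/existsP; exists j; rewrite ji /= ej; apply/eqP/val_inj/eqP.
    by rewrite eqn_leq at_ -ltnS ta.
split; last by move=> i; rewrite /outcome sp.
apply/andP; split; apply/forallP => i; rewrite sp //.
by case: (hs i) => [->|[-> _]]; rewrite eqxx ?orbT.
Qed.

(** * Ranks, and the parking function built from a map to blocks *)

Lemma card_ord_lt (n c : nat) : c <= n -> #|[set k : 'I_n | k < c]| = c.
Proof.
move=> le; rewrite -[RHS]card_ord.
have w_inj : injective (widen_ord le).
  by move=> x y /(congr1 val) /= xy; apply/val_inj.
rewrite -(card_imset _ w_inj); apply: eq_card => k; rewrite inE.
apply/idP/imsetP => [kc|[j _ ->]]; last exact: (ltn_ord j).
by exists (Ordinal kc) => //; exact/val_inj.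
Qed.

Lemma injective_rank (n : nat) (s : 'I_n -> 'I_n) (i : 'I_n) :
  injective s -> #|[set j | s j < s i]| = s i.
Proof.
move=> s_inj; rewrite -(card_imset _ s_inj).
have -> : s @: [set j | s j < s i] = [set k : 'I_n | k < s i].
  apply/setP => k; rewrite inE; apply/imsetP/idP => [[j]|ki].
    by rewrite inE => ji ->.
  have [g sK gK] := injF_bij s_inj.
  by exists (g k); rewrite ?inE gK.
by rewrite card_ord_lt // ltnW.
Qed.

Section Blocks.
Variables (n m : nat).
Implicit Types (f : {ffun 'I_n -> 'I_m}) (i j k : 'I_n).

Definition lex_lt f j i := (f j < f i) || (f j == f i) && (j < i).

(** Singles out the cars that are not first in their block; they become the unlucky ones. *)
Definition repeated f i := [exists j, (f j == f i) && (j < i)].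

Lemma lex_ltxx f i : lex_lt f i i = false.
Proof. by rewrite /lex_lt !ltnn andbF. Qed.

Lemma lex_lt_trans f i j k : lex_lt f i j -> lex_lt f j k -> lex_lt f i k.
Proof.
rewrite /lex_lt => /orP[ij|/andP[/eqP-> ij]] /orP[jk|/andP[/eqP<- jk]].
- by rewrite (ltn_trans ij jk).
- by rewrite ij.
- by rewrite jk.
- by rewrite eqxx (ltn_trans ij jk) orbT.
Qed.

Lemma lex_lt_total f i j : i != j -> lex_lt f i j || lex_lt f j i.
Proof.
rewrite /lex_lt [f j == _]eq_sym -!val_eqE.
by case: (ltngtP (f i) (f j)) => //= _; case: (ltngtP i j).
Qed.

Lemma lex_rank_proof f i : #|[set j | lex_lt f j i]| < n.
Proof.
rewrite -[ltnRHS]card_ord -cardsT; apply: proper_card; apply/properP; split.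
  exact: finset.subsetT.
by exists i; rewrite ?inE // lex_ltxx.
Qed.

Definition lex_rank f i : 'I_n := Ordinal (lex_rank_proof f i).

Lemma ltn_lex_rank f i j : (lex_rank f i < lex_rank f j) = lex_lt f i j.
Proof.
have homo k l : lex_lt f k l -> lex_rank f k < lex_rank f l.
  move=> kl; apply: proper_card; apply/properP; split.
    by apply/fintype.subsetP => x; rewrite !inE => /lex_lt_trans; exact.
  by exists k; rewrite !inE ?lex_ltxx.
apply/idP/idP => [ij|]; last exact: homo.
have [eij|/(lex_lt_total f)/orP[//|/homo/ltnW]] := eqVneq i j.
  by rewrite eij ltnn in ij.
by rewrite leqNgt ij.
Qed.

Lemma lex_rank_inj f : injective (lex_rank f).
Proof.
move=> i j eij; apply/eqP; apply: contraT => /(lex_lt_total f).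
by rewrite -!ltn_lex_rank eij ltnn.
Qed.

Lemma block_pref_proof f i : lex_rank f i - repeated f i < n.
Proof. exact: leq_ltn_trans (leq_subr _ _) (ltn_ord _). Qed.

(** The boolean [repeated f i] is subtracted as 0 or 1: the first car of a block prefers the spot it
    gets, every later one the spot just before. *)
Definition block_pref f : n.-tuple 'I_n :=
  [tuple Ordinal (block_pref_proof f i) | i < n].

(** The car [j] ranked just below [i] lies lexicographically between an earlier car [k] of the same
    block and [i], which forces it into that block and before [i]. *)
Lemma repeated_prev f i : repeated f i ->
  exists2 j : 'I_n, j < i & lex_rank f i = (lex_rank f j).+1 :> nat.
Proof.
move=> /existsP[k /andP[/eqP fk ki]].
have : lex_lt f k i by rewrite /lex_lt fk eqxx ki orbT.
rewrite -ltn_lex_rank => k_lt_i.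
have [g _ gK] := injF_bij (@lex_rank_inj f).
have lt : (lex_rank f i).-1 < n by exact: leq_ltn_trans (leq_pred _) (ltn_ord _).
pose j := g (Ordinal lt).
have ej : (lex_rank f j).+1 = lex_rank f i by rewrite gK /= (ltn_predK k_lt_i).
exists j => //.
have : ~~ lex_lt f j k by rewrite -ltn_lex_rank -leqNgt -ltnS ej.
have : lex_lt f j i by rewrite -ltn_lex_rank -ej.
rewrite /lex_lt -fk => /orP[->//|/andP[_ ->//]].
Qed.

Lemma block_prefP f :
  [/\ unit_interval_pf (block_pref f), outcome (block_pref f) =1 lex_rank f &
      forall i, lucky (block_pref f) i = ~~ repeated f i].
Proof.
have tE i : tnth (block_pref f) i = lex_rank f i - repeated f i :> nat.
  by rewrite tnth_mktuple.
have [|i|ua oE] := @outcome_unique _ (block_pref f) (lex_rank f).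
- exact: lex_rank_inj.
- have [r|iN] := boolP (repeated f i).
    have [j ji e] := repeated_prev r.
    right; rewrite tE r e subn1; split=> //; exists j => //.
    by apply/val_inj; rewrite [RHS]tE r e subn1.
  by left; apply/val_inj; rewrite [RHS]tE (negPf iN) subn0.
split=> // i; rewrite luckyE // oE -(inj_eq (@ord_inj n)) tE.
have [r|] := boolP (repeated f i); last by rewrite subn0 eqxx.
have [j _ e] := repeated_prev r.
by rewrite e subn1 /= gtn_eqF.
Qed.

Lemma unrepeated_inj f : {in [pred i | ~~ repeated f i] &, injective f}.
Proof.
move=> i j; rewrite !inE => iN jN fij; apply/val_inj.
case: (ltngtP i j) => // ij.
  by case/negP: jN; apply/existsP; exists i; rewrite fij eqxx ij.
by case/negP: iN; apply/existsP; exists j; rewrite fij eqxx ij.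
Qed.

Lemma codom_unrepeated f (x : 'I_m) :
  x \in codom f -> exists2 i, ~~ repeated f i & f i = x.
Proof.
move=> /codomP[i0 ->].
case: (@arg_minnP _ i0 [pred i | f i == f i0] val) => [|i /eqP fi imin].
  exact: eqxx.
exists i => //; apply/existsP => -[j /andP[/eqP fj ji]].
by have := imin j; rewrite inE fj fi eqxx leqNgt ji => /(_ isT).
Qed.

Lemma num_lucky_block_pref f :
  [forall x, x \in codom f] -> num_lucky (block_pref f) = m.
Proof.
move=> /forallP fs; have [_ _ lE] := block_prefP f.
rewrite /num_lucky; under eq_finset do rewrite lE.
rewrite -(card_in_imset (f := f)) => [|i j]; last first.
  rewrite !inE; exact: unrepeated_inj.
rewrite -[RHS]card_ord; apply: eq_card => x; rewrite inE.
have [i iN <-] := codom_unrepeated (fs x).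
by rewrite imset_f ?inE.
Qed.

(** By surjectivity each block up to that of [i] contributes exactly one lucky car, its first. Hence
    [f] can be read off from the parking function, which gives injectivity of [block_pref]. *)
Lemma block_index f i : [forall x, x \in codom f] ->
  (f i).+1 = #|[set j | lucky (block_pref f) j &
                        outcome (block_pref f) j <= outcome (block_pref f) i]|.
Proof.
move=> /forallP fs; have [_ oE lE] := block_prefP f.
have -> : [set j | lucky (block_pref f) j &
                   outcome (block_pref f) j <= outcome (block_pref f) i] =
          [set j | ~~ repeated f j & f j <= f i].
  apply/setP => j; rewrite !inE lE !oE.
  have [|jN] := boolP (repeated f j) => //=.
  (* For an unrepeated [j] the tie-break in [lex_lt] is void: an earlier [i] in the same block would
     make [j] repeated. *)
  rewrite leqNgt ltn_lex_rank /lex_lt [RHS]leqNgt; congr (~~ _).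
  case: eqP => [e|_]; last by rewrite orbF.
  case: (ltnP i j) => [ij|_]; rewrite ?orbF //; case/negP: jN.
  by apply/existsP; exists i; rewrite e eqxx ij.
rewrite -(card_in_imset (f := f)) => [|j k]; last first.
  rewrite !inE => /andP[jN _] /andP[kN _]; exact: unrepeated_inj.
rewrite -(card_ord_lt (ltn_ord (f i))); apply: eq_card => x.
rewrite inE ltnS; apply/idP/imsetP => [xi|[j]].
  by have [j jN ej] := codom_unrepeated (fs x); exists j; rewrite ?inE ?jN ej.
by rewrite inE => /andP[_ ji] ->.
Qed.

Lemma block_pref_inj :
  {in [set f : {ffun 'I_n -> 'I_m} | [forall x, x \in codom f]] &,
   injective block_pref}.
Proof.
move=> f g; rewrite !inE => fs gs efg; apply/ffunP => i; apply/val_inj.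
by apply: succn_inj; rewrite !block_index // efg.
Qed.

Lemma block_pref_of_lex_rank f (a : n.-tuple 'I_n) :
  unit_interval_pf a -> outcome a =1 lex_rank f ->
  (forall i, lucky a i = ~~ repeated f i) -> block_pref f = a.
Proof.
move=> ua oE lE; apply: eq_from_tnth => i; apply/val_inj.
rewrite tnth_mktuple /= -[#|_|]/(lex_rank f i : nat) -oE.
have := lE i; have [il|iN] := boolP (lucky a i).
  move=> /esym/negPf->; move: il; rewrite luckyE // => /eqP ->.
  by rewrite subn0.
have [j _ [_ ->]] := unluckyP ua iN.
by move=> /esym/negbFE->; rewrite subn1.
Qed.

End Blocks.

(** * The inverse construction: from a parking function to its blocks *)

Section BlockOf.
Variables (n m : nat) (a : n.-tuple 'I_n).
Hypotheses (ua : unit_interval_pf a) (am : num_lucky a = m.+1).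
Implicit Types (i j k : 'I_n).

Let below i := [set j | lucky a j & outcome a j <= outcome a i].

(** Blocks are numbered from 0, hence the predecessor. The default value of [inord] never occurs,
    since [below i] is nonempty and has at most [m.+1] elements. *)
Definition block_of : {ffun 'I_n -> 'I_m.+1} := [ffun i => inord #|below i|.-1].

(** Descent on spots: an unlucky car has a car directly to its left, so moving left must reach a
    lucky one. *)
Lemma card_below_gt0 i : 0 < #|below i|.
Proof.
have [d] := ubnP (outcome a i); elim: d i => // d IHd i id.
have [il|/(unluckyP ua)[j _ [ej ei]]] := boolP (lucky a i).
  by apply/card_gt0P; exists i; rewrite inE il leqnn.
have /card_gt0P[k] : 0 < #|below j|.
  by apply: IHd; move: id; rewrite ei ej.
rewrite inE => /andP[kl kj]; apply/card_gt0P; exists k.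
by rewrite inE kl (leq_trans kj) // ei ej.
Qed.

Lemma block_ofE i : block_of i = #|below i|.-1 :> nat.
Proof.
rewrite ffunE inordK // (ltn_predK (card_below_gt0 i)) -am.
by apply: subset_leq_card; apply/fintype.subsetP => j; rewrite !inE => /andP[].
Qed.

Lemma leq_block_of i j : outcome a i <= outcome a j -> block_of i <= block_of j.
Proof.
move=> ij; rewrite !block_ofE -!subn1 leq_sub2r //; apply: subset_leq_card.
by apply/fintype.subsetP => k; rewrite !inE => /andP[-> /leq_trans->].
Qed.

Lemma ltn_block_of i j k : lucky a k ->
  outcome a i < outcome a k <= outcome a j -> block_of i < block_of j.
Proof.
move=> kl /andP[ik kj]; rewrite !block_ofE -ltnS !(ltn_predK (card_below_gt0 _)).
apply: proper_card; apply/properP; split.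
  apply/fintype.subsetP => l; rewrite !inE => /andP[-> /leq_trans->//].
  exact: leq_trans (ltnW ik) kj.
by exists k; rewrite !inE kl ?kj // -ltnNge.
Qed.

(** If two cars share a block, no lucky spot separates them, so [lt_of_no_lucky] gives their arrival
    order. The converse follows by trichotomy. *)
Lemma lex_lt_block_of i j : lex_lt block_of i j = (outcome a i < outcome a j).
Proof.
have homo k l : outcome a k < outcome a l -> lex_lt block_of k l.
  move=> kl; rewrite /lex_lt; have := leq_block_of (ltnW kl).
  rewrite leq_eqVlt orbC => /orP[->//|e]; rewrite val_eqE in e; rewrite e /=.
  apply/orP; right; apply: (lt_of_no_lucky ua kl) => x xl /(ltn_block_of xl).
  by rewrite (eqP e) ltnn.
apply/idP/idP => [ij|]; last exact: homo.
case: (ltngtP (outcome a i) (outcome a j)) => // [/homo ji|/val_inj/(outcome_inj ua) e].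
  by have := lex_lt_trans ij ji; rewrite lex_ltxx.
by rewrite e lex_ltxx in ij.
Qed.

Lemma lex_rank_block_of : outcome a =1 lex_rank block_of.
Proof.
move=> i; apply/val_inj; rewrite /= -[LHS](injective_rank _ (outcome_inj ua)).
by apply: eq_card => j; rewrite !inE lex_lt_block_of.
Qed.

Lemma repeated_block_of i : lucky a i = ~~ repeated block_of i.
Proof.
have [il|/(unluckyP ua)[j ji [ej ei]]] := boolP (lucky a i).
  apply/esym/existsP => -[j /andP[/eqP e ji]].
  have : lex_lt block_of j i by rewrite /lex_lt e eqxx ji orbT.
  rewrite lex_lt_block_of => lt.
  have : block_of j < block_of i by apply: (ltn_block_of il); rewrite lt leqnn.
  by rewrite e ltnn.
apply/esym/negbTE/negPn/existsP; exists j; rewrite ji andbT.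
have jSi : outcome a i = (outcome a j).+1 :> nat by rewrite ei ej.
have : lex_lt block_of j i by rewrite lex_lt_block_of jSi.
rewrite /lex_lt => /orP[|/andP[->//]]; rewrite !block_ofE.
(* Passing from the spot of [j] to the next one adds only car [i], which is unlucky, so no new block
   starts. *)
suff -> : below i = below j by rewrite ltnn.
apply/setP => k; rewrite !inE; have [kl|//] := boolP (lucky a k).
rewrite /= jSi leq_eqVlt ltnS; case: eqP => //= e.
have := kl; rewrite (_ : k = i) ?luckyE //; last first.
  by apply: (outcome_inj ua); apply/val_inj; rewrite /= e jSi.
by rewrite -val_eqE /= ei gtn_eqF.
Qed.

(** The [m.+1] lucky cars are the first cars of their blocks, so they lie in distinct blocks and
    exhaust ['I_m.+1]. *)
Lemma block_of_surj : [forall x, x \in codom block_of].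
Proof.
have L_inj : {in [set i | lucky a i] &, injective block_of}.
  move=> i j; rewrite !inE !repeated_block_of; exact: unrepeated_inj.
have : block_of @: [set i | lucky a i] = finset.setT.
  by apply/eqP; rewrite eqEcard finset.subsetT /= cardsT card_ord card_in_imset // -am.
move=> /setP e; apply/forallP => x; have := e x; rewrite inE => /imsetP[i _ ->].
exact: codom_f.
Qed.

Lemma block_ofK : block_pref block_of = a.
Proof.
exact: (block_pref_of_lex_rank ua lex_rank_block_of repeated_block_of).
Qed.

End BlockOf.

(** * Counting by surjections and inclusion-exclusion *)

Lemma num_lucky_gt0 (n : nat) (a : n.-tuple 'I_n) :
  0 < n -> unit_interval_pf a -> 0 < num_lucky a.
Proof.
move=> n_gt0 ua; have := @card_below_gt0 _ a ua (Ordinal n_gt0).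
move=> /leq_trans; apply; apply: subset_leq_card.
by apply/fintype.subsetP => i; rewrite !inE => /andP[].
Qed.

Lemma card_upf_lucky (n m : nat) : 0 < n ->
  #|[set a : n.-tuple 'I_n | unit_interval_pf a & num_lucky a == m]| =
  #|[set f : {ffun 'I_n -> 'I_m} | [forall x, x \in codom f]]|.
Proof.
move=> n_gt0; rewrite -(card_in_imset (@block_pref_inj n m)).
apply: eq_card => a; rewrite inE; apply/andP/imsetP => [[ua /eqP am]|[f]].
  (* [block_of] needs a codomain of the form ['I_m.+1]; zero lucky cars cannot occur because the
     street is nonempty. *)
  case: m am => [|m] am; first by have := num_lucky_gt0 n_gt0 ua; rewrite am.
  by exists (block_of m a); rewrite ?inE ?block_of_surj ?block_ofK.
rewrite inE => fs ->; rewrite num_lucky_block_pref //.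
by case: (block_prefP f).
Qed.

Local Open Scope ring_scope.

Lemma card_surjections (n m : nat) :
  #|[set f : {ffun 'I_n -> 'I_m} | [forall x, x \in codom f]]|%:Z =
  \sum_(0 <= j < m.+1) (-1) ^+ (m - j) * 'C(m, j)%:Z * j%:Z ^+ n.
Proof.
have indicator (f : {ffun 'I_n -> 'I_m}) : [forall x, x \in codom f]%:Z =
    \sum_(A : {set 'I_m}) (-1) ^+ (m - #|A|) * (f \in ffun_on (mem A))%:Z.
  transitivity (\prod_x (1 + - (x \notin codom f)%:Z)).
    have [/forallP fs|] := boolP [forall x, x \in codom f].
      by rewrite big1 // => x _; rewrite fs subr0.
    by move=> /forallPn[x xN]; rewrite (bigD1 x) //= xN subrr mul0r.
  (* [A] collects the factors contributing 1. The remaining product is, up to sign, 1 if all values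
     of [f] lie in [A] and 0 otherwise. *)
  rewrite bigA_distr; apply: eq_bigr => A _.
  have -> : (m - #|A|)%N = #|~: A| by rewrite [RHS]cardsCs finset.setCK card_ord.
  rewrite (bigID (mem A)) /= big1 ?mul1r => [|x ->//].
  rewrite (eq_bigr (fun x => -1 * (x \notin codom f)%:Z)); last first.
    by move=> x /negPf->; rewrite mulN1r.
  rewrite big_split /= prodr_const; congr (_ ^+ _ * _).
    by apply: eq_card => x; rewrite !inE.
  have [/ffun_onP fA|] := boolP (f \in _).
    rewrite big1 // => x xN; rewrite (_ : x \notin codom f) //.
    by apply: contra xN => /codomP[i ->]; exact: fA.
  move=> fN; have /forallPn[i iN] : ~~ [forall i, f i \in A].
    by apply: contra fN => /forallP fA; apply/ffun_onP.
  by rewrite (bigD1 (f i)) //= codom_f mul0r.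
transitivity (\sum_(f : {ffun 'I_n -> 'I_m}) [forall x, x \in codom f]%:Z).
  rewrite -sum1dep_card big_mkcond /= -natz natr_sum.
  by apply: eq_bigr => f _; rewrite natz; case: ifP.
under eq_bigr do rewrite indicator.
rewrite exchange_big /= big_mkord.
have card_lt (A : {set 'I_m}) : (#|A| < m.+1)%N.
  by rewrite ltnS -[leqRHS]card_ord max_card.
(* Subsets are grouped by cardinality [j]: each admits [j ^ n] maps, and there are ['C(m, j)] of
   them. *)
rewrite (partition_big (fun A : {set 'I_m} => Ordinal (card_lt A)) xpredT) //=.
apply: eq_bigr => j _.
rewrite (eq_bigr (fun=> (-1) ^+ (m - j) * j%:Z ^+ n)) => [|A /eqP <-]; last first.
  rewrite -mulr_sumr; congr (_ * _) => /=.
  rewrite -[in RHS](card_ord n) -natz -natrX -(card_ffun_on _ (mem A)).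
  rewrite -sum1_card [in RHS]big_mkcond /= natr_sum.
  by apply: eq_bigr => f _; rewrite natz; case: ifP.
rewrite sumr_const mulrAC -mulr_natr natz; congr (_ * _%:Z).
have := card_draws 'I_m j; rewrite card_ord => <-; rewrite -[LHS]cardsE.
by apply: eq_card => A; rewrite !inE.
Qed.

(** * Summation over the admissible numbers of lucky cars *)

Lemma card_UPF_T1 (n : nat) (S : set nat) :
  #|UPF_T1 n S| =
  (\sum_(m < n.+1 | (m : nat) \in S)
    #|[set a : n.-tuple 'I_n | unit_interval_pf a & num_lucky a == m]%SET|)%N.
Proof.
have lucky_lt (a : n.-tuple 'I_n) : (num_lucky a < n.+1)%N.
  by rewrite ltnS -[leqRHS]card_ord max_card.
rewrite /UPF_T1 -sum1dep_card.
rewrite (partition_big (fun a => Ordinal (lucky_lt a))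
  (fun m : 'I_n.+1 => (m : nat) \in S)) /= => [|a /andP[]//].
apply: eq_bigr => m mS; rewrite -[RHS]sum1dep_card; apply: eq_bigl => a.
by rewrite -val_eqE /= -andbA; case: eqP => [->|]; rewrite ?mS ?andbF.
Qed.

Lemma card_upf_lucky_gt (n m : nat) : (n < m)%N ->
  #|[set a : n.-tuple 'I_n | unit_interval_pf a & num_lucky a == m]%SET| = 0%N.
Proof.
move=> nm; apply/eqP; rewrite cards_eq0; apply/eqP/setP => a; rewrite !inE.
apply/negP => /andP[_ /eqP am].
have := max_card (mem [set i | lucky a i]%SET).
by rewrite card_ord -/(num_lucky a) am leqNgt nm.
Qed.

Unset Implicit Arguments.
Local Open Scope classical_set_scope.
Local Open Scope ring_scope.

(* [\sum_(m \in S)] sums over the elements of S with nonzero term; S may be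
   infinite. *)
Theorem theorem3p10 (n : nat) (S : set nat)
    (n_gt0 : (0 < n)%N)
    (S_even : S `<=` [set m : nat | (0 < m)%N /\ ~~ odd m]) :
  #|UPF_T1 n S|%:Z =
  \sum_(m \in S) \sum_(1 <= j < m.+1)
     (-1) ^+ (m - j) * 'C(m, j)%:Z * j%:Z ^+ n.
Proof.
have term m : \sum_(1 <= j < m.+1) (-1) ^+ (m - j) * 'C(m, j)%:Z * j%:Z ^+ n =
    #|[set a : n.-tuple 'I_n | unit_interval_pf a & num_lucky a == m]%SET|%:Z.
  rewrite card_upf_lucky // card_surjections [RHS]big_ltn //.
  by rewrite expr0n eqn0Ngt n_gt0 mulr0 add0r.
under eq_fsbigr do rewrite term.
(* There are at most [n] lucky cars, so terms with [m > n] vanish and the sum over a possibly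
   infinite [S] becomes one over a finite range. *)
rewrite -(fsbig_widen (S `&` `I_n.+1)) => [|m []//|m [mS mN]]; last first.
  rewrite /= card_upf_lucky_gt // ltnNge; apply/negP => mn.
  by apply: mN; split=> //=; rewrite ltnS.
rewrite setIC fsbig_mkcondr -fsbig_ord -big_mkcond /= card_UPF_T1 -natz natr_sum.
by apply: eq_bigr => m _; rewrite natz.
Qed.
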